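(* Consider any run of the iterative time series aggregation algorithm described in the context, with any choice of clustering (that is, any choice of the partition of $\boldsymbol{T}$ into $K^i$ nonempty clusters at each iteration $i$). Let $J(\boldsymbol{z}^\star)$ be the optimal objective value of the full-scale model (F). Then for every iteration $i\ge 0$ that is executed: (1) the operational optimization with investment variables fixed to $\hat x_g^\star,\hat b_g^\star$ is feasible, and the point $\{\hat x_g^\star,\hat b_g^\star,p_{g,t}^\star,d_t^{\mathrm{ns}\star} \mid g\in\boldsymbol{G}, t\in\boldsymbol{T}\}$ computed in that iteration is a feasible solution to the full-scale model (F); (2) the bounds computed in that iteration are valid: $$J^{\mathrm{LB},\,i+1}\ \le\ J(\boldsymbol{z}^\star)\ \le\ J^{\mathrm{UB},\,i+1}.$$ In particular, the bounds returned at termination satisfy $J^{\mathrm{LB}\,\star}\le J(\boldsymbol{z}^\star)\le J^{\mathrm{UB}\,\star}$.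
   Context: Let $\boldsymbol{G}$ (generators) and $\boldsymbol{T}$ (time periods) be finite nonempty sets. The given real parameters are: operational costs $C^{\mathrm{op}}_g$, investment costs $C^{\mathrm{inv}}_g$, and minimum and maximum installable capacities $0\le\underline{X}_g\le\overline{X}_g$ for $g\in\boldsymbol{G}$; a penalty cost $C^{\mathrm{ns}}$ for non-supplied demand; capacity factors $F_{g,t}\in[0,1]$ and demands $D_t$ for $g\in\boldsymbol{G}$, $t\in\boldsymbol{T}$; and a sampling time $\Delta>0$. Full-scale model (F): the decision variables are $\boldsymbol{z}=\{x_g, b_g, p_{g,t}, d^{\mathrm{ns}}_t \mid g\in\boldsymbol{G}, t\in\boldsymbol{T}\}$ with $x_g, p_{g,t}, d^{\mathrm{ns}}_t$ real and $b_g\in\{0,1\}$. Minimize $$J(\boldsymbol{z}) := \sum_{g\in\boldsymbol{G}} C^{\mathrm{inv}}_g x_g + \sum_{t\in\boldsymbol{T}}\Big(\sum_{g\in\boldsymbol{G}} C^{\mathrm{op}}_g p_{g,t}\Delta + C^{\mathrm{ns}} d^{\mathrm{ns}}_t\Big)$$ subject to: $\sum_{g\in\boldsymbol{G}} p_{g,t}\Delta + d^{\mathrm{ns}}_t = D_t$ for all $t$; $0\le p_{g,t}\le F_{g,t}x_g$ for all $g,t$; $b_g\underline{X}_g\le x_g\le b_g\overline{X}_g$ for all $g$. Let $\boldsymbol{z}^\star$ denote an optimal solution of (F). Aggregated model (A) for a partition $\{\boldsymbol{T}_k \mid k\in\boldsymbol{K}\}$ of $\boldsymbol{T}$ into nonempty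 clusters, with $T_k:=|\boldsymbol{T}_k|$: the decision variables are $\boldsymbol{\hat z}=\{\hat x_g,\hat b_g,\hat p_{g,k},\hat d^{\mathrm{ns}}_k \mid g\in\boldsymbol{G}, k\in\boldsymbol{K}\}$ with $\hat x_g,\hat p_{g,k},\hat d^{\mathrm{ns}}_k$ real and $\hat b_g\in\{0,1\}$. Minimize $$\hat J(\boldsymbol{\hat z}) := \sum_{g\in\boldsymbol{G}} C^{\mathrm{inv}}_g \hat x_g + \sum_{k\in\boldsymbol{K}} T_k\Big(\sum_{g\in\boldsymbol{G}} C^{\mathrm{op}}_g \hat p_{g,k}\Delta + C^{\mathrm{ns}}\hat d^{\mathrm{ns}}_k\Big)$$ subject to: $\sum_{g\in\boldsymbol{G}}\hat p_{g,k}\Delta + \hat d^{\mathrm{ns}}_k = \frac{1}{T_k}\sum_{t\in\boldsymbol{T}_k} D_t$ for all $k$; $0\le \hat p_{g,k}\le \frac{\hat x_g}{T_k}\sum_{t\in\boldsymbol{T}_k}F_{g,t}$ for all $g,k$; $\hat b_g\underline{X}_g\le\hat x_g\le\hat b_g\overline{X}_g$ for all $g$. Operational optimization: given fixed values $\hat x_g^\star,\hat b_g^\star$ of the investment variables, it is the full-scale model (F) with $x_g=\hat x_g^\star$ and $b_g=\hat b_g^\star$ fixed for all $g$, minimized over the remaining variables $p_{g,t}, d^{\mathrm{ns}}_t$ (it separates over $t\in\boldsymbol{T}$). Algorithm. Inputs: the parameters above, an initial number of clusters $K^0$, a positive integer step size $\alpha$, a threshold $\epsilon^{\mathrm{thr}}$,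 and a maximum number of iterations $\overline I$. Initialize $i=0$, $\epsilon^0=+\infty$. While $\epsilon^i>\epsilon^{\mathrm{thr}}$ and $i\le\overline I$, do: (a) choose, by any clustering technique, a partition of $\boldsymbol{T}$ into $K^i$ nonempty clusters; (b) compute an optimal solution $\boldsymbol{\hat z}^\star=\{\hat x_g^\star,\hat b_g^\star,\hat p_{g,k}^\star,\hat d_k^{\mathrm{ns}\star}\}$ of (A) for this partition and set $\tilde J^{\mathrm{LB}}:=\hat J(\boldsymbol{\hat z}^\star)$; (c) compute an optimal solution $\{p_{g,t}^\star,d_t^{\mathrm{ns}\star}\}$ of the operational optimization with investment variables fixed to $\hat x_g^\star,\hat b_g^\star$, and set $\tilde J^{\mathrm{UB}}:=J(\{\hat x_g^\star,\hat b_g^\star,p_{g,t}^\star,d_t^{\mathrm{ns}\star}\})$; (d) if $i=0$, set $J^{\mathrm{LB},\,1}:=\tilde J^{\mathrm{LB}}$ and $J^{\mathrm{UB},\,1}:=\tilde J^{\mathrm{UB}}$; otherwise set $J^{\mathrm{LB},\,i+1}:=\max(J^{\mathrm{LB},\,i},\tilde J^{\mathrm{LB}})$ and $J^{\mathrm{UB},\,i+1}:=\min(J^{\mathrm{UB},\,i},\tilde J^{\mathrm{UB}})$; (e) set $\epsilon^{i+1}:=(J^{\mathrm{UB},\,i+1}-J^{\mathrm{LB},\,i+1})/J^{\mathrm{UB},\,i+1}$, $K^{i+1}:=K^i+\alpha\lfloor\epsilon^{i+1}\rfloor$, and $i:=i+1$. On termination return $J^{\mathrm{UB}\,\star}:=J^{\mathrm{UB},\,i}$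 and $J^{\mathrm{LB}\,\star}:=J^{\mathrm{LB},\,i}$. Runs are considered only as long as the steps are well defined ($1\le K^i\le|\boldsymbol{T}|$ when step (a) is performed, and $J^{\mathrm{UB},\,i+1}\ne 0$ when step (e) is performed). *)

(* Defs.v *)
From HB Require Import structures.
From mathcomp Require Import all_boot all_order all_algebra.
From mathcomp Require Import constructive_ereal reals.

Set Implicit Arguments.
Unset Strict Implicit.
Unset Printing Implicit Defensive.

Import Order.TTheory GRing.Theory Num.Theory.
Local Open Scope ring_scope.

Definition is_minimizer (R : realType) (X : Type) (feasible : X -> Prop)
    (obj : X -> R) (z : X) : Prop :=
  feasible z /\ forall z', feasible z' -> obj z <= obj z'.

(* Generators G and time periods T.  Operational and investment costs, minimum
   and maximum installable capacities, penalty cost for non-supplied demand,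
   capacity factors, demands and sampling time. *)
Record params (R : realType) (G T : finType) := Params {
  Cop : G -> R;
  Cinv : G -> R;
  Xmin : G -> R;
  Xmax : G -> R;
  Cns : R;
  capF : G -> T -> R;
  demand : T -> R;
  Delta : R
}.

Record valid_params (R : realType) (G T : finType) (pr : params R G T) : Prop :=
  ValidParams {
  Xmin_ge0 : forall g, 0 <= Xmin pr g;
  Xmin_le_Xmax : forall g, Xmin pr g <= Xmax pr g;
  capF_ge0 : forall g t, 0 <= capF pr g t;
  capF_le1 : forall g t, capF pr g t <= 1;
  Delta_gt0 : 0 < Delta pr
}.

(* Binary variables are booleans, cast to R by (_)%:R in the constraints;
   the non-supplied demand is a free real variable. *)
Record full_point (R : realType) (G T : finType) := FullPoint {
  fx : G -> R;
  fb : G -> bool;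
  fp : G -> T -> R;
  fd : T -> R
}.

Definition full_obj (R : realType) (G T : finType) (pr : params R G T)
    (z : full_point R G T) : R :=
  \sum_(g : G) Cinv pr g * fx z g
  + \sum_(t : T) (\sum_(g : G) Cop pr g * fp z g t * Delta pr
                  + Cns pr * fd z t).

Record full_feasible (R : realType) (G T : finType) (pr : params R G T)
    (z : full_point R G T) : Prop := FullFeasible {
  full_balance : forall t,
    \sum_(g : G) fp z g t * Delta pr + fd z t = demand pr t;
  full_capacity : forall g t, 0 <= fp z g t <= capF pr g t * fx z g;
  full_investment : forall g,
    (fb z g)%:R * Xmin pr g <= fx z g <= (fb z g)%:R * Xmax pr g
}.

Definition full_optimal (R : realType) (G T : finType) (pr : params R G T)
    (z : full_point R G T) : Prop :=
  is_minimizer (full_feasible pr) (full_obj pr) z.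

(* The index set of the aggregated model: the blocks of the partition P. *)
Definition cluster (T : finType) (P : {set {set T}}) : finType :=
  {B : {set T} | B \in P}.

Definition block (T : finType) (P : {set {set T}}) (k : cluster P) : {set T} :=
  val k.

Record agg_point (R : realType) (G T : finType) (P : {set {set T}}) :=
  AggPoint {
  ax : G -> R;
  ab : G -> bool;
  ap : G -> cluster P -> R;
  ad : cluster P -> R
}.

Definition agg_obj (R : realType) (G T : finType) (pr : params R G T)
    (P : {set {set T}}) (z : agg_point R G P) : R :=
  \sum_(g : G) Cinv pr g * ax z g
  + \sum_(k : cluster P) #|block k|%:R *
      (\sum_(g : G) Cop pr g * ap z g k * Delta pr + Cns pr * ad z k).

Record agg_feasible (R : realType) (G T : finType) (pr : params R G T)
    (P : {set {set T}}) (z : agg_point R G P) : Prop := AggFeasible {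
  agg_balance : forall k,
    \sum_(g : G) ap z g k * Delta pr + ad z k
    = 1 / #|block k|%:R * \sum_(t in block k) demand pr t;
  agg_capacity : forall g k,
    0 <= ap z g k <= ax z g / #|block k|%:R * \sum_(t in block k) capF pr g t;
  agg_investment : forall g,
    (ab z g)%:R * Xmin pr g <= ax z g <= (ab z g)%:R * Xmax pr g
}.

Definition agg_optimal (R : realType) (G T : finType) (pr : params R G T)
    (P : {set {set T}}) (z : agg_point R G P) : Prop :=
  is_minimizer (agg_feasible pr (P := P)) (agg_obj pr (P := P)) z.

Record op_point (R : realType) (G T : finType) := OpPoint {
  op_p : G -> T -> R;
  op_d : T -> R
}.

Definition with_investment (R : realType) (G T : finType)
    (x : G -> R) (b : G -> bool) (o : op_point R G T) : full_point R G T :=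
  FullPoint x b (op_p o) (op_d o).

Definition op_feasible (R : realType) (G T : finType) (pr : params R G T)
    (x : G -> R) (b : G -> bool) (o : op_point R G T) : Prop :=
  full_feasible pr (with_investment x b o).

Definition op_optimal (R : realType) (G T : finType) (pr : params R G T)
    (x : G -> R) (b : G -> bool) (o : op_point R G T) : Prop :=
  is_minimizer (op_feasible pr x b)
    (fun o' => full_obj pr (with_investment x b o')) o.

Record alg_inputs (R : realType) := AlgInputs {
  K0 : nat;
  alpha : nat;
  eps_thr : R;
  Imax : nat
}.

(* The values taken by the variables of the algorithm, indexed by the iteration
   counter.  An entry is meaningful only once it has been assigned: the
   predicates below constrain exactly the entries that have been, and LB 0 and
   UB 0 are never read.  The number of clusters is an integer because its
   update adds a floor that may be negative. *)
Record trace (R : realType) (G T : finType) := Trace {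
  eps : nat -> \bar R;
  nK : nat -> int;
  part : nat -> {set {set T}};
  zhat : forall i, agg_point R G (part i);
  oper : nat -> op_point R G T;
  LB : nat -> R;
  UB : nat -> R
}.

Section Algorithm.
Variables (R : realType) (G T : finType) (pr : params R G T).
Variables (inp : alg_inputs R) (tr : trace R G T).

Definition full_candidate (i : nat) : full_point R G T :=
  with_investment (ax (zhat tr i)) (ab (zhat tr i)) (oper tr i).

Definition tildeLB (i : nat) : R := agg_obj pr (zhat tr i).
Definition tildeUB (i : nat) : R := full_obj pr (full_candidate i).

Definition initialized : Prop :=
  eps tr 0 = +oo%E /\ nK tr 0 = (K0 inp)%:Z.

Definition loop_test (i : nat) : Prop :=
  ((eps_thr inp)%:E < eps tr i)%E /\ (i <= Imax inp)%N.

Definition step_a (i : nat) : Prop :=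
  [/\ 1 <= nK tr i <= #|T|%:Z,
      partition (part tr i) [set: T] &
      #|part tr i|%:Z = nK tr i].

Definition step_b (i : nat) : Prop := agg_optimal pr (zhat tr i).

Definition step_c (i : nat) : Prop :=
  op_optimal pr (ax (zhat tr i)) (ab (zhat tr i)) (oper tr i).

Definition step_d (i : nat) : Prop :=
  LB tr i.+1 = (if i == 0%N then tildeLB i
                else Num.max (LB tr i) (tildeLB i)) /\
  UB tr i.+1 = (if i == 0%N then tildeUB i
                else Num.min (UB tr i) (tildeUB i)).

Definition gap (i : nat) : R := (UB tr i - LB tr i) / UB tr i.

Definition step_e (i : nat) : Prop :=
  [/\ UB tr i.+1 != 0,
      eps tr i.+1 = (gap i.+1)%:E &
      nK tr i.+1 = nK tr i + (alpha inp)%:Z * Num.floor (gap i.+1)].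

(* The algorithm has been started and has completed iterations 0, ..., n-1. *)
Definition completed (n : nat) : Prop :=
  initialized /\
  forall i, (i < n)%N ->
    loop_test i /\ [/\ step_a i, step_b i, step_c i, step_d i & step_e i].

Definition terminated (n : nat) : Prop := completed n /\ ~ loop_test n.

End Algorithm.

(* Main.v *)
Require Import Defs.
From HB Require Import structures.
From mathcomp Require Import all_boot all_order all_algebra.
From mathcomp Require Import constructive_ereal reals.

(** The aggregated model is a relaxation of the full-scale one: averaging a
    feasible point of the full-scale model over each cluster gives a feasible
    point of the aggregated model, because the balance is linear and the
    capacity bound is linear in [(p, F)] once the investment [x] is fixed; and
    the objective is unchanged, because the weight [T_k] cancels the averaging
    factor ([aggregate_feasible], [aggregate_obj]).  Hence the optimal value of
    the aggregated model never exceeds the full-scale optimum, whatever the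
    partition ([tildeLB_le]).

    Conversely, an aggregated solution has nonnegative capacities that satisfy
    the full-scale investment constraints, so that producing nothing and leaving
    the whole demand unserved completes it to a full-scale feasible point
    ([idle_feasible]).  Any such completion costs at least the full-scale
    optimum ([tildeUB_ge]).

    Running maxima of lower bounds and running minima of upper bounds are again
    bounds, which gives the invariant of the loop ([step_d_bounds],
    [completed_bounds]).  At termination at least one iteration has been
    executed, since the initial gap is infinite, so the invariant applies. *)

Set Implicit Arguments.
Unset Strict Implicit.
Unset Printing Implicit Defensive.

Import Order.TTheory GRing.Theory Num.Theory.
Local Open Scope ring_scope.

Section Average.
Variables (R : realType) (T : finType).
Implicit Types (B : {set T}) (f : T -> R).

Definition average B f : R := (\sum_(t in B) f t) / #|B|%:R.

Lemma averageD B f1 f2 :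
  average B (fun t => f1 t + f2 t) = average B f1 + average B f2.
Proof. by rewrite /average big_split /= mulrDl. Qed.

Lemma averageZ B a f : average B (fun t => a * f t) = a * average B f.
Proof. by rewrite /average -mulr_sumr mulrA. Qed.

Lemma average_sum (I : finType) B (f : I -> T -> R) :
  average B (fun t => \sum_i f i t) = \sum_i average B (f i).
Proof. by rewrite /average exchange_big /= mulr_suml. Qed.

Lemma eq_average B f1 f2 : f1 =1 f2 -> average B f1 = average B f2.
Proof. by move=> eqf; rewrite /average; congr (_ / _); apply: eq_bigr. Qed.

Lemma le_average B f1 f2 :
  (forall t, f1 t <= f2 t) -> average B f1 <= average B f2.
Proof.
move=> lef; apply: ler_wpM2r; first by rewrite invr_ge0 ler0n.
exact: ler_sum.
Qed.

Lemma average_ge0 B f : (forall t, 0 <= f t) -> 0 <= average B f.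
Proof. by move=> f0; rewrite divr_ge0 ?ler0n// sumr_ge0. Qed.

Lemma card_average B f : (0 < #|B|)%N -> #|B|%:R * average B f = \sum_(t in B) f t.
Proof. by move=> B0; rewrite mulrC divfK// pnatr_eq0 -lt0n. Qed.

Lemma sum_cluster_average (P : {set {set T}}) f :
  partition P [set: T] ->
  \sum_(k : cluster P) #|block k|%:R * average (block k) f = \sum_t f t.
Proof.
move=> partP; have [_ _ P0] := and3P partP.
have -> : \sum_t f t = \sum_(t in [set: T]) f t.
  by apply: eq_bigl => t; rewrite inE.
rewrite (set_partition_big _ partP) /=.
rewrite [RHS](big_sub (mem P)) /=.
apply: eq_bigr => k _; rewrite card_average// card_gt0.
by apply: contraNneq P0 => <-; exact: valP k.
Qed.

End Average.

Section Bounds.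
Variables (R : realType) (G T : finType) (pr : params R G T).

Definition aggregate (P : {set {set T}}) (z : full_point R G T) :
    agg_point R G P :=
  AggPoint (fx z) (fb z) (fun g k => average (block k) (fp z g))
           (fun k => average (block k) (fd z)).

Lemma aggregate_feasible (P : {set {set T}}) (z : full_point R G T) :
  full_feasible pr z -> agg_feasible pr (aggregate P z).
Proof.
move=> [balance capacity investment]; split=> //= [k | g k].
- rewrite mul1r [RHS]mulrC -[RHS]/(average (block k) (demand pr)).
  rewrite -(eq_average _ balance) averageD average_sum.
  by congr (_ + _); apply: eq_bigr => g _; rewrite mulrC -averageZ;
    apply: eq_average => t; rewrite mulrC.
- rewrite average_ge0/= => [|t]; last by have /andP[] := capacity g t.
  rewrite mulrAC -mulrA -[X in _ <= _ * X]/(average (block k) (capF pr g)).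
  rewrite -averageZ; apply: le_average => t.
  by rewrite mulrC; have /andP[] := capacity g t.
Qed.

(** Within one cluster the operating cost is linear in the operation, so the
    cost of the averaged operation is the average cost; weighting it by the
    size of the cluster restores the total cost over the cluster. *)
Lemma aggregate_obj (P : {set {set T}}) (z : full_point R G T) :
  partition P [set: T] -> agg_obj pr (aggregate P z) = full_obj pr z.
Proof.
move=> partP; rewrite /agg_obj /full_obj /=; congr (_ + _).
rewrite -(sum_cluster_average _ partP); apply: eq_bigr => k _; congr (_ * _).
rewrite averageD averageZ average_sum; congr (_ + _).
apply: eq_bigr => g _; rewrite mulrAC -averageZ.
by apply: eq_average => t; rewrite mulrAC.
Qed.

Definition idle : op_point R G T := OpPoint (fun _ _ => 0) (demand pr).

(** The lower capacity limits make the installed capacities nonnegative, so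
    that zero production respects the capacity constraints; the non-supplied
    demand, being free, absorbs the whole balance. *)
Lemma idle_feasible (P : {set {set T}}) (z : agg_point R G P) :
  valid_params pr -> agg_feasible pr z -> op_feasible pr (ax z) (ab z) idle.
Proof.
move=> hpr [_ _ investment]; split=> //= [t | g t].
- by rewrite big1 ?add0r// => g _; rewrite mul0r.
- rewrite lexx mulr_ge0 ?(capF_ge0 hpr)//.
  have /andP[+ _] := investment g; apply: le_trans.
  by rewrite mulr_ge0 ?ler0n ?(Xmin_ge0 hpr).
Qed.

Variable zstar : full_point R G T.
Hypothesis hzstar : full_optimal pr zstar.
Variable tr : trace R G T.

Definition valid_bounds (n : nat) : Prop :=
  LB tr n <= full_obj pr zstar /\ full_obj pr zstar <= UB tr n.

Lemma tildeLB_le (i : nat) :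
  step_a tr i -> step_b pr tr i -> tildeLB pr tr i <= full_obj pr zstar.
Proof.
move=> [_ partP _] [_ zhat_min]; rewrite -(aggregate_obj _ partP).
by apply: zhat_min; apply: aggregate_feasible; case: hzstar.
Qed.

Lemma tildeUB_ge (i : nat) :
  step_c pr tr i -> full_obj pr zstar <= tildeUB pr tr i.
Proof. by case: hzstar => _ zstar_min [feas _]; apply: zstar_min. Qed.

(** Bounds available before the iteration are required only when [i] is
    positive: the first iteration overwrites them instead of combining. *)
Lemma step_d_bounds (i : nat) :
  ((0 < i)%N -> valid_bounds i) ->
  step_a tr i -> step_b pr tr i -> step_c pr tr i -> step_d pr tr i ->
  valid_bounds i.+1.
Proof.
move=> prev a b c [LBi UBi]; rewrite /valid_bounds LBi UBi.
have leLB := tildeLB_le a b; have geUB := tildeUB_ge c.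
case: i prev {a b c LBi UBi} leLB geUB => [//|i] /(_ isT)[LBi UBi] leLB geUB /=.
by rewrite ge_max le_min LBi UBi leLB geUB.
Qed.

Lemma completed_bounds (inp : alg_inputs R) (n : nat) :
  completed pr inp tr n -> (0 < n)%N -> valid_bounds n.
Proof.
move=> [_ steps]; elim: n steps => [//|n IHn] steps _.
have [_ [a b c d _]] := steps n (ltnSn n).
apply: step_d_bounds => //; apply: IHn => i lt_in.
by apply: steps; apply: ltnW.
Qed.

End Bounds.

Theorem mainTheorem3 (R : realType) (G T : finType)
  (hG : (0 < #|G|)%N) (hT : (0 < #|T|)%N)
  (pr : params R G T) (hpr : valid_params pr)
  (zstar : full_point R G T) (hzstar : full_optimal pr zstar)
  (inp : alg_inputs R) (halpha : (0 < alpha inp)%N)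
  (tr : trace R G T) :
  (forall i : nat,
     completed pr inp tr i -> loop_test inp tr i ->
     step_a tr i -> step_b pr tr i ->
     (exists o : op_point R G T,
        op_feasible pr (ax (zhat tr i)) (ab (zhat tr i)) o) /\
     (step_c pr tr i ->
        full_feasible pr (full_candidate tr i) /\
        (step_d pr tr i ->
           LB tr i.+1 <= full_obj pr zstar /\
           full_obj pr zstar <= UB tr i.+1)))
  /\
  (forall n : nat,
     terminated pr inp tr n ->
     LB tr n <= full_obj pr zstar /\ full_obj pr zstar <= UB tr n).
Proof.
split=> [i run _ a b | n [run stop]].
- split; first by exists (idle pr); apply: idle_feasible => //; case: b.
  move=> c; split=> [|d]; first by case: c.
  exact: (step_d_bounds hzstar (completed_bounds hzstar run) a b c d).
- apply: (completed_bounds hzstar run); rewrite lt0n; apply/eqP => n0.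
  (* The loop test holds at n = 0 because the initial gap is +oo. *)
  by apply: stop; case: run => -[eps0 _] _; rewrite n0 /loop_test eps0 ltry.
Qed.
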